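(* Let $$\widetilde A_{T_v}=\langle b,u,v \mid [u,v]=1,\ b\,b^{v^{-1}}b^{v}=b^{v^{-1}}b^{v}\,b\rangle$$ be the generalized Alexander group of the virtual trefoil $T_v$, and let $$G=\langle a,x,y\mid [x,y]=1,\ (a^{x}a^{y})a^{xy}=a(a^{x}a^{y})\rangle$$ be the fundamental group of the complement of the knot in the thickened torus that represents the virtual trefoil. Then the groups $\widetilde A_{T_v}$ and $G$ are not isomorphic.
   Context: Notation: $a^b=b^{-1}ab$ and $[a,b]=a^{-1}b^{-1}ab$. The two groups are to be understood as the groups given by the displayed finite presentations. *)

(* Defs.v *)
From HB Require Import structures.
From mathcomp Require Import all_boot.
From mathcomp Require Import boolp.

Set Implicit Arguments.
Unset Strict Implicit.
Unset Printing Implicit Defensive.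

Local Open Scope group_scope.
Local Open Scope quotient_scope.

(* Unreduced words: (x, true) is the letter x and (x, false) its formal
   inverse.  Words form only a baseGroupType (w^-1 * w is not the empty word),
   which is what x ^ y and [~ x, y] need. *)
Definition word (X : Type) := seq (X * bool).

Definition inv_word (X : Type) (w : word X) : word X :=
  rev [seq (l.1, ~~ l.2) | l <- w].

HB.instance Definition _ (X : choiceType) := Choice.on (word X).
HB.instance Definition _ (X : Type) := hasMul.Build (word X) (@cat (X * bool)).
HB.instance Definition _ (X : Type) := hasOne.Build (word X) [::].
HB.instance Definition _ (X : Type) := hasInv.Build (word X) (@inv_word X).

Definition gen (X : Type) (x : X) : word X := [:: (x, true)].

(* A presentation is a list R of relations r.1 = r.2; eq_pres R is the
   congruence on words generated by R and free cancellation. *)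
Inductive eq_pres (X : choiceType) (R : seq (word X * word X)) :
    word X -> word X -> Prop :=
| eq_pres_rel r : r \in R -> eq_pres R r.1 r.2
| eq_pres_cancel x e : eq_pres R [:: (x, e); (x, ~~ e)] 1
| eq_pres_mul w1 w2 w1' w2' :
    eq_pres R w1 w1' -> eq_pres R w2 w2' -> eq_pres R (w1 * w2) (w1' * w2')
| eq_pres_refl w : eq_pres R w w
| eq_pres_sym w1 w2 : eq_pres R w1 w2 -> eq_pres R w2 w1
| eq_pres_trans w1 w2 w3 :
    eq_pres R w1 w2 -> eq_pres R w2 w3 -> eq_pres R w1 w3.

Section PresentedGroup.
Variables (X : choiceType) (R : seq (word X * word X)).

Lemma word_mulA (w1 w2 w3 : word X) : w1 * (w2 * w3) = w1 * w2 * w3.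
Proof. exact: catA. Qed.

Lemma word_mulw1 (w : word X) : w * 1 = w.
Proof. exact: cats0. Qed.

Lemma inv_wordK : involutive (@inv_word X).
Proof.
move=> w; rewrite /inv_word map_rev revK -map_comp map_id_in //.
by move=> [x e] _ /=; rewrite negbK.
Qed.

Lemma eq_pres_mulV (w : word X) : eq_pres R (w * w^-1) 1.
Proof.
elim: w => [|[x e] w IHw]; first exact: eq_pres_refl.
pose l b : word X := [:: (x, b)].
have -> : ((x, e) :: w : word X) * ((x, e) :: w : word X)^-1 =
    l e * (((w : word X) * (w : word X)^-1) * l (~~ e)).
  by rewrite /mul /= -catA /inv /= /inv_word /= rev_cons -cats1.
apply: eq_pres_trans (eq_pres_cancel R x e).
apply: (eq_pres_mul (eq_pres_refl R (l e))).
exact: eq_pres_mul IHw (eq_pres_refl R (l (~~ e))).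
Qed.

Lemma eq_pres_Vmul (w : word X) : eq_pres R (w^-1 * w) 1.
Proof. by have := eq_pres_mulV w^-1; rewrite {2}/inv /= inv_wordK. Qed.

Lemma eq_pres_inv (w1 w2 : word X) :
  eq_pres R w1 w2 -> eq_pres R w1^-1 w2^-1.
Proof.
move=> w12; rewrite -[w1^-1]word_mulw1.
apply: (@eq_pres_trans _ _ _ (w1^-1 * (w2 * w2^-1))).
  exact: eq_pres_mul (eq_pres_refl _ _) (eq_pres_sym (eq_pres_mulV w2)).
rewrite word_mulA.
apply: (eq_pres_mul (w2' := w2^-1) (w1' := 1)); last exact: eq_pres_refl.
apply: eq_pres_trans (eq_pres_Vmul w1).
exact: eq_pres_mul (eq_pres_refl _ _) (eq_pres_sym w12).
Qed.

Definition eq_presb (w1 w2 : word X) : bool := `[< eq_pres R w1 w2 >].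

Lemma eq_presb_equiv : equiv_class_of eq_presb.
Proof.
split=> [w|w1 w2|w2 w1 w3]; first exact/asboolP/eq_pres_refl.
  by apply/asboolP/asboolP; apply: eq_pres_sym.
by move=> /asboolP w12 /asboolP w23; apply/asboolP/(eq_pres_trans w12 w23).
Qed.

Canonical eq_presb_equiv_rel := EquivRelPack eq_presb_equiv.

Definition presented : Type := {eq_quot eq_presb}.
HB.instance Definition _ := Choice.on presented.
HB.instance Definition _ := EqQuotient.on presented.

Definition pres_pi (w : word X) : presented := \pi_presented w.

Lemma pres_piP (w1 w2 : word X) : pres_pi w1 = pres_pi w2 <-> eq_pres R w1 w2.
Proof. by split=> [/eqmodP/asboolP|?]; last exact/eqmodP/asboolP. Qed.

Lemma pres_piK (g : presented) : pres_pi (repr g) = g.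
Proof. exact: reprK. Qed.

Lemma repr_pres_pi (w : word X) : eq_pres R (repr (pres_pi w)) w.
Proof. exact/pres_piP/pres_piK. Qed.

Definition pres_mul (g h : presented) := pres_pi (repr g * repr h).
Definition pres_inv (g : presented) := pres_pi (repr g)^-1.

Lemma pres_pi_mul (w1 w2 : word X) :
  pres_mul (pres_pi w1) (pres_pi w2) = pres_pi (w1 * w2).
Proof. exact/pres_piP/eq_pres_mul/repr_pres_pi/repr_pres_pi. Qed.

Lemma pres_pi_inv (w : word X) : pres_inv (pres_pi w) = pres_pi w^-1.
Proof. exact/pres_piP/eq_pres_inv/repr_pres_pi. Qed.

Lemma pres_mulA : associative pres_mul.
Proof.
move=> g h k; rewrite -(pres_piK g) -(pres_piK h) -(pres_piK k) !pres_pi_mul.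
by rewrite word_mulA.
Qed.

Lemma pres_mul1 : left_id (pres_pi 1) pres_mul.
Proof. by move=> g; rewrite -(pres_piK g) pres_pi_mul. Qed.

Lemma pres_mulr1 : right_id (pres_pi 1) pres_mul.
Proof. by move=> g; rewrite -(pres_piK g) pres_pi_mul word_mulw1. Qed.

Lemma pres_mulV : left_inverse (pres_pi 1) pres_inv pres_mul.
Proof.
move=> g; rewrite -(pres_piK g) pres_pi_inv pres_pi_mul.
exact/pres_piP/eq_pres_Vmul.
Qed.

Lemma pres_mulrV : right_inverse (pres_pi 1) pres_inv pres_mul.
Proof.
move=> g; rewrite -(pres_piK g) pres_pi_inv pres_pi_mul.
exact/pres_piP/eq_pres_mulV.
Qed.

HB.instance Definition _ := isGroup.Build presented
  pres_mulA pres_mul1 pres_mulr1 pres_mulV pres_mulrV.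

End PresentedGroup.

Definition isomorphic (G H : groupType) : Prop :=
  exists f : {multiplicative G -> H}, bijective f.

Definition gen0 : word 'I_3 := gen (@Ordinal 3 0 isT).
Definition gen1 : word 'I_3 := gen (@Ordinal 3 1 isT).
Definition gen2 : word 'I_3 := gen (@Ordinal 3 2 isT).

(* Generators b, u, v. *)
Definition alexander_virtual_trefoil : groupType :=
  let b := gen0 in let u := gen1 in let v := gen2 in
  presented [::
    ([~ u, v], 1);
    (b * b ^ v^-1 * b ^ v, b ^ v^-1 * b ^ v * b)].

(* Generators a, x, y. *)
Definition thickened_torus_virtual_trefoil : groupType :=
  let a := gen0 in let x := gen1 in let y := gen2 in
  presented [::
    ([~ x, y], 1);
    ((a ^ x * a ^ y) * a ^ (x * y), a * (a ^ x * a ^ y))].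

(* Main.v *)
Require Import Defs.
From HB Require Import structures.
From mathcomp Require Import all_boot.
From mathcomp Require Import boolp ssralg zmodp.

(* Isomorphic groups have equally many homomorphisms to the symmetric group of
   degree 3.  A homomorphism out of a presented group is a choice of images of
   the generators that satisfies the relations, so both numbers can be computed:
   there are 90 for the generalized Alexander group and 72 for the knot group. *)

Set Implicit Arguments.
Unset Strict Implicit.
Unset Printing Implicit Defensive.

Local Open Scope group_scope.

Section Evaluation.
Variables (X : choiceType) (gT : groupType).
Implicit Types (s : X -> gT) (w : word X) (R : seq (word X * word X)).

Definition eval_letter s (l : X * bool) : gT :=
  if l.2 then s l.1 else (s l.1)^-1.

Definition eval s w : gT := foldr (fun l g => eval_letter s l * g) 1 w.

Definition satisfies R s : bool := all (fun r => eval s r.1 == eval s r.2) R.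

Lemma eval_mul s w1 w2 : eval s (w1 * w2) = eval s w1 * eval s w2.
Proof.
elim: w1 => [|l w1 IHw]; first by rewrite mul1g.
by rewrite /= -mulgA -IHw.
Qed.

Lemma eval_gen s x : eval s (gen x) = s x.
Proof. exact: mulg1. Qed.

Lemma eval_eq_pres R s w1 w2 :
  satisfies R s -> eq_pres R w1 w2 -> eval s w1 = eval s w2.
Proof.
move=> /allP Rs; elim=> {w1 w2} [r /Rs/eqP //|x e||//|//|].
- by case: e; rewrite /eval /= /eval_letter /= mulg1 ?mulgV ?mulVg.
- by move=> w1 w2 w1' w2' _ e1 _ e2; rewrite !eval_mul e1 e2.
- by move=> w1 w2 w3 _ -> _ ->.
Qed.

End Evaluation.

Section HomExtension.
Variables (X : choiceType) (R : seq (word X * word X)) (gT : groupType).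

(** Evaluates one chosen representative, so it is independent of that choice, and a homomorphism,
    once [s] satisfies [R]. *)
Definition pres_lift (s : X -> gT) (g : presented R) : gT := eval s (repr g).

Lemma pres_lift_pi s w : satisfies R s -> pres_lift s (pres_pi R w) = eval s w.
Proof. by move=> Rs; apply: eval_eq_pres Rs (repr_pres_pi R w). Qed.

Lemma pres_lift_mul s :
  satisfies R s -> {morph pres_lift s : g h / g * h >-> g * h}.
Proof. by move=> Rs g h; rewrite {1}/mul /= pres_lift_pi // eval_mul. Qed.

(** A homomorphism is determined by its values on the generators. *)
Lemma eval_hom (f : presented R -> gT) w :
    {morph f : g h / g * h >-> g * h} ->
  eval (fun x => f (pres_pi R (gen x))) w = f (pres_pi R w).
Proof.
move=> fM; have f1: f (pres_pi R 1) = 1.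
  by apply: (@mulgI _ (f 1)); rewrite mulg1 -fM mulg1.
elim: w => [|[x e] w IHw] /=; first by rewrite f1.
have -> : pres_pi R ((x, e) :: w) = pres_pi R [:: (x, e)] * pres_pi R w.
  by rewrite /mul /= pres_pi_mul.
rewrite fM -IHw; congr (_ * _); rewrite /eval_letter /=.
(* For an inverse letter, multiplying by the image of [x] on the left makes both sides 1. *)
case: e => //=; apply: (@mulgI _ (f (pres_pi R (gen x)))).
by rewrite mulgV -fM {1}/mul /= pres_pi_mul -f1; congr f;
  apply/esym/pres_piP/(eq_pres_cancel R x true).
Qed.

Lemma satisfies_hom (f : presented R -> gT) :
    {morph f : g h / g * h >-> g * h} ->
  satisfies R (fun x => f (pres_pi R (gen x))).
Proof.
move=> fM; apply/allP=> r Rr; rewrite !eval_hom //.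
by apply/eqP; congr f; apply/pres_piP/eq_pres_rel.
Qed.

End HomExtension.

Section TripleCount.
Variables (gT : groupType) (elts : seq gT).
Hypotheses (elts_uniq : uniq elts) (mem_elts : forall g, g \in elts).

(** Triples, unlike functions on ['I_3], can be listed and filtered by computation. The default 1 is
    never reached. *)
Definition assign (t : gT * gT * gT) (i : 'I_3) : gT :=
  nth 1 [:: t.1.1; t.1.2; t.2] i.

Definition triples : seq (gT * gT * gT) :=
  [seq (g, h) | g <- [seq (g, h) | g <- elts, h <- elts], h <- elts].

Definition sat_triples (R : seq (word 'I_3 * word 'I_3)) :=
  [seq t <- triples | satisfies R (assign t)].

Lemma triples_uniq : uniq triples.
Proof.
by rewrite !allpairs_uniq => //; move=> [a b] [c d] _ _ [-> ->].
Qed.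

Lemma mem_triples t : t \in triples.
Proof.
case: t => [[a b] c]; apply/allpairs_f => //; exact/allpairs_f.
Qed.

Definition triple_of (s : 'I_3 -> gT) : gT * gT * gT :=
  (s (@Ordinal 3 0 isT), s (@Ordinal 3 1 isT), s (@Ordinal 3 2 isT)).

Lemma triple_ofK s : assign (triple_of s) =1 s.
Proof. by case=> [[|[|[|//]]] i3]; congr s; apply: val_inj. Qed.

Lemma assignK : cancel assign triple_of.
Proof. by case=> [[]]. Qed.

(** Precomposition with the inverse isomorphism sends homomorphisms out of [presented R] injectively
    to homomorphisms out of [presented Q]. *)
Lemma isomorphic_sat_triples (R Q : seq (word 'I_3 * word 'I_3)) :
    isomorphic (presented R) (presented Q) ->
  size (sat_triples R) <= size (sat_triples Q).
Proof.
case=> f [f' fK f'K]; have f'M := can2_gmulfM fK f'K.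
pose push t (g : presented Q) := pres_lift (assign t) (f' g : presented R).
have pushM t : t \in sat_triples R -> {morph push t : g h / g * h >-> g * h}.
  rewrite mem_filter => /andP[Rt _] g h.
  by rewrite /push f'M pres_lift_mul.
(* The triple that encodes the transported homomorphism [push t]. *)
pose F t := triple_of (fun i => push t (pres_pi Q (gen i))).
have assignF t : assign (F t) = fun i => push t (pres_pi Q (gen i)).
  by apply/funext=> i; rewrite triple_ofK.
have evalF t w : t \in sat_triples R ->
    eval (assign (F t)) w = push t (pres_pi Q w).
  by move=> Rt; rewrite assignF eval_hom //; apply: pushM.
rewrite -(size_map F); apply: uniq_leq_size => [|_ /mapP[t Rt ->]].
  rewrite map_inj_in_uniq ?filter_uniq ?triples_uniq // => t1 t2 Rt1 Rt2 eqF.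
  apply: (can_inj assignK); apply/funext=> i.
  have push_gen t : t \in sat_triples R ->
      push t (f (pres_pi R (gen i))) = assign t i.
    rewrite mem_filter => /andP[Rt _].
    by rewrite /push fK pres_lift_pi // eval_gen.
  (* [f] of a generator is the class of a word over the generators of [Q], and the value of [push t]
     on it depends only on [F t]. *)
  rewrite -push_gen // -[RHS]push_gen // -(pres_piK (f _)).
  by rewrite -!evalF // eqF.
rewrite mem_filter mem_triples andbT assignF.
exact/satisfies_hom/pushM.
Qed.

End TripleCount.

(* The symmetric group of degree 3, realised as the affine group of Z/3 (whose
   operations compute, unlike those of {perm 'I_3}): (e, i) stands for the map
   k |-> i + k, or i - k if e is true, and maps are composed left to right. *)
Definition aff3 : Type := (bool * 'I_3)%type.

HB.instance Definition _ := Choice.on aff3.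

Definition aff3_twist (e : bool) (i : 'I_3) : 'I_3 := (if e then - i else i)%R.

Definition aff3_mul (g h : aff3) : aff3 :=
  (g.1 (+) h.1, aff3_twist h.1 g.2 + h.2)%R.

Definition aff3_one : aff3 := (false, 0%R).

(** Reflections are involutions, so only translations get negated. *)
Definition aff3_inv (g : aff3) : aff3 := (g.1, aff3_twist (~~ g.1) g.2).

Lemma aff3_mulA : associative aff3_mul.
Proof.
move=> [e i] [d j] [c k]; congr (_, _); rewrite /= ?addbA // /aff3_twist.
by case: c; case: d; rewrite /= ?GRing.opprD ?GRing.opprK ?GRing.addrA.
Qed.

Lemma aff3_mul1g : left_id aff3_one aff3_mul.
Proof. by case=> [[] i]; congr (_, _); rewrite /= ?GRing.oppr0 GRing.add0r. Qed.

Lemma aff3_mulg1 : right_id aff3_one aff3_mul.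
Proof. by case=> [[] i]; congr (_, _); rewrite /= GRing.addr0. Qed.

Lemma aff3_mulVg : left_inverse aff3_one aff3_inv aff3_mul.
Proof. by case=> [[] i]; congr (_, _); rewrite /= GRing.addNr. Qed.

Lemma aff3_mulgV : right_inverse aff3_one aff3_inv aff3_mul.
Proof. by case=> [[] i]; congr (_, _); rewrite /= ?GRing.addNr ?GRing.addrN. Qed.

HB.instance Definition _ := isGroup.Build aff3
  aff3_mulA aff3_mul1g aff3_mulg1 aff3_mulVg aff3_mulgV.

Definition aff3_elts : seq aff3 :=
  [seq (e, i) | e <- [:: true; false], i <- [:: inZp 0; inZp 1; inZp 2]].

Lemma mem_aff3_elts (g : aff3) : g \in aff3_elts.
Proof. by case: g => [[] [[|[|[|//]]] i3]]. Qed.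

Theorem proposition8 :
  ~ isomorphic alexander_virtual_trefoil thickened_torus_virtual_trefoil.
Proof.
have aff3_elts_uniq: uniq aff3_elts by [].
move/(isomorphic_sat_triples aff3_elts_uniq mem_aff3_elts).
(* Filtering the 216 triples for each presentation reduces the inequality to 90 <= 72, which is
   false. *)
by vm_compute.
Qed.
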